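(* Let $p \ge 1$ and $n \ge 2$ be integers with $\gcd(p,n)=1$. Let $\mathcal{T}(p,2)$ be the $(p,2)$-torus link and let $\mathbb{Z}_n$ be the dihedral quandle of order $n$. Then the full $\mathbb{Z}_n$-quandle coloring quiver of $\mathcal{T}(p,2)$ is (up to isomorphism of directed multigraphs) the complete directed graph $$\mathcal{Q}_{\mathbb{Z}_n}(\mathcal{T}(p,2)) = \left(\overleftrightarrow{K_{n}},\hat{n}\right).$$
   Context: A quandle is a non-empty set $X$ with a binary operation $\triangleright$ such that: (1) $x\triangleright x=x$ for all $x$; (2) for every $y$ the map $x\mapsto x\triangleright y$ is invertible; (3) $(x\triangleright y)\triangleright z=(x\triangleright z)\triangleright(y\triangleright z)$ for all $x,y,z$. A quandle homomorphism is a map $f$ with $f(a\triangleright b)=f(a)\triangleright f(b)$; $Hom(X,Y)$ denotes the set of quandle homomorphisms $X\to Y$. The dihedral quandle $\mathbb{Z}_n$ ($n\ge 2$) is $\{0,1,\dots,n-1\}$ with $x\triangleright y=(2y-x) \bmod n$. The $(p,2)$-torus link $\mathcal{T}(p,2)$, $p\ge1$, is the closure of the 2-strand braid $\sigma_1^p$. Its fundamental quandle $Q(\mathcal{T}(p,2))$ is the quandle generated by the arc labels $x_1,\dots,x_p$ with the relations $x_2\triangleright x_1=x_p$, $x_1\triangleright x_p=x_{p-1}$, and $x_i\triangleright x_{i-1}=x_{i-2}$ for $3\le i\le p$; that is, $x_i\triangleright x_{i-1}=x_{i-2}$ for all $i$, with indices read modulo $p$. For a finite quandle $X$ and an oriented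 link $K$ with fundamental quandle $Q(K)$, the full $X$-quandle coloring quiver $\mathcal{Q}_X(K)$ is the directed multigraph (loops and multiple edges allowed) with one vertex $v_f$ for each $f\in Hom(Q(K),X)$ and, for each $\phi\in Hom(X,X)$ with $g=\phi\circ f$, one directed edge from $v_f$ to $v_g$. Thus the number of edges from $v_f$ to $v_g$ is the number of $\phi\in Hom(X,X)$ with $g=\phi\circ f$. $(\overleftrightarrow{K_m},\hat{k})$ denotes the directed multigraph on $m$ vertices having exactly $k$ directed edges from each vertex to every vertex, including exactly $k$ loops at each vertex. *)

(* Defs.v *)
From HB Require Import structures.
From mathcomp Require Import all_boot all_algebra.
From mathcomp Require Import boolp ring.

Set Implicit Arguments.
Unset Strict Implicit.
Unset Printing Implicit Defensive.

Local Open Scope quotient_scope.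

Reserved Notation "x ▷ y" (at level 40, left associativity).

HB.mixin Record isQuandle (X : Type) := {
  qop : X -> X -> X;
  quandle_inhabited : inhabited X;
  qopxx : forall x, qop x x = x;
  qop_bij : forall y, bijective (fun x => qop x y);
  qop_dist : forall x y z, qop (qop x y) z = qop (qop x z) (qop y z)
}.

#[short(type="quandleType")]
HB.structure Definition Quandle := {X of isQuandle X}.

Declare Scope quandle_scope.
Notation "x ▷ y" := (qop x y) : quandle_scope.
Local Open Scope quandle_scope.

(* Equality of homomorphisms is equality of the underlying functions, by
   functional extensionality and proof irrelevance. *)
Record quandle_hom (X Y : quandleType) := QuandleHom {
  quandle_hom_fun :> X -> Y;
  quandle_homP : forall a b,
    quandle_hom_fun (a ▷ b) = quandle_hom_fun a ▷ quandle_hom_fun b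
}.

(* 'Z_n is {0, ..., n-1} with arithmetic modulo n only when 1 < n. *)
Definition dihedral (n : nat) : Type := 'Z_n.

Section Dihedral.
Variable n : nat.
Local Open Scope ring_scope.

Definition dihedral_op (x y : dihedral n) : dihedral n :=
  (y : 'Z_n) *+ 2 - (x : 'Z_n).

Lemma dihedral_inhabited : inhabited (dihedral n).
Proof. exact: (inhabits (0 : 'Z_n)). Qed.

Lemma dihedral_opxx x : dihedral_op x x = x.
Proof. by rewrite /dihedral_op GRing.mulr2n GRing.addrK. Qed.

Lemma dihedral_op_bij y : bijective (fun x => dihedral_op x y).
Proof.
by exists (fun x => dihedral_op x y) => x; rewrite /dihedral_op GRing.subKr.
Qed.

Lemma dihedral_op_dist x y z :
  dihedral_op (dihedral_op x y) z =
  dihedral_op (dihedral_op x z) (dihedral_op y z).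
Proof. rewrite /dihedral_op; ring. Qed.

HB.instance Definition _ := isQuandle.Build (dihedral n)
  dihedral_inhabited dihedral_opxx dihedral_op_bij dihedral_op_dist.

End Dihedral.

(* Formal quandle words on the generators G; [QInv t u] stands for the
   preimage of t under the map x |-> x ▷ u. *)
Inductive qterm (G : Type) : Type :=
| QGen of G
| QOp of qterm G & qterm G
| QInv of qterm G & qterm G.

HB.instance Definition _ (G : Type) := gen_eqMixin (qterm G).
HB.instance Definition _ (G : Type) := gen_choiceMixin (qterm G).

Section Presentation.
Variables (G : Type) (R : qterm G -> qterm G -> Prop).

(* The least congruence that contains R and the quandle axioms. *)
Inductive qcong : qterm G -> qterm G -> Prop :=
| qcong_rel t u : R t u -> qcong t u
| qcong_refl t : qcong t t
| qcong_sym t u : qcong t u -> qcong u t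
| qcong_trans t u v : qcong t u -> qcong u v -> qcong t v
| qcong_op t t' u u' : qcong t t' -> qcong u u' -> qcong (QOp t u) (QOp t' u')
| qcong_inv t t' u u' :
    qcong t t' -> qcong u u' -> qcong (QInv t u) (QInv t' u')
| qcong_idem t : qcong (QOp t t) t
| qcong_opK t u : qcong (QInv (QOp t u) u) t
| qcong_invK t u : qcong (QOp (QInv t u) u) t
| qcong_dist t u v :
    qcong (QOp (QOp t u) v) (QOp (QOp t v) (QOp u v)).

Definition qcongb (t u : qterm G) : bool := `[< qcong t u >].

Lemma qcongb_refl : reflexive qcongb.
Proof. by move=> t; apply/asboolP; exact: qcong_refl. Qed.

Lemma qcongb_sym : symmetric qcongb.
Proof. by move=> t u; apply/asboolP/asboolP; exact: qcong_sym. Qed.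

Lemma qcongb_trans : transitive qcongb.
Proof.
move=> u t v /asboolP tu /asboolP uv; apply/asboolP.
exact: qcong_trans tu uv.
Qed.

Canonical qcong_equiv := EquivRel qcongb qcongb_refl qcongb_sym qcongb_trans.

(* The quandle < G | R >.  The proof that G is inhabited only serves to make
   the carrier non-empty. *)
Definition presented (G0 : inhabited G) : Type := {eq_quot qcong_equiv}.

Variable G0 : inhabited G.

Definition presented_pi (t : qterm G) : presented G0 :=
  \pi_({eq_quot qcong_equiv}) t.

Definition presented_repr (x : presented G0) : qterm G :=
  repr (x : {eq_quot qcong_equiv}).

Lemma presented_reprK : cancel presented_repr presented_pi.
Proof. exact: reprK. Qed.

Lemma presented_piP t u : presented_pi t = presented_pi u <-> qcong t u.
Proof.
split=> [/eqP|tu]; first by rewrite /presented_pi eqmodE => /asboolP.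
by apply/eqP; rewrite /presented_pi eqmodE; apply/asboolP.
Qed.

Lemma presented_repr_pi t : qcong (presented_repr (presented_pi t)) t.
Proof. by apply/presented_piP; rewrite presented_reprK. Qed.

Definition presented_op (x y : presented G0) : presented G0 :=
  presented_pi (QOp (presented_repr x) (presented_repr y)).

Definition presented_inv (x y : presented G0) : presented G0 :=
  presented_pi (QInv (presented_repr x) (presented_repr y)).

Lemma presented_opE t u :
  presented_op (presented_pi t) (presented_pi u) = presented_pi (QOp t u).
Proof.
by apply/presented_piP/qcong_op; exact: presented_repr_pi.
Qed.

Lemma presented_invE t u :
  presented_inv (presented_pi t) (presented_pi u) = presented_pi (QInv t u).
Proof.
by apply/presented_piP/qcong_inv; exact: presented_repr_pi.
Qed.

Lemma presented_inhabited : inhabited (presented G0).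
Proof. by case: G0 => g; exact: (inhabits (presented_pi (QGen g))). Qed.

Lemma presented_opxx x : presented_op x x = x.
Proof.
rewrite -[x]presented_reprK presented_opE; apply/presented_piP.
exact: qcong_idem.
Qed.

Lemma presented_op_bij y : bijective (fun x => presented_op x y).
Proof.
exists (fun x => presented_inv x y) => x;
  rewrite -[x]presented_reprK -[y]presented_reprK.
  by rewrite presented_opE presented_invE; apply/presented_piP/qcong_opK.
by rewrite presented_invE presented_opE; apply/presented_piP/qcong_invK.
Qed.

Lemma presented_op_dist x y z :
  presented_op (presented_op x y) z =
  presented_op (presented_op x z) (presented_op y z).
Proof.
rewrite -[x]presented_reprK -[y]presented_reprK -[z]presented_reprK.
by rewrite !presented_opE; apply/presented_piP/qcong_dist.
Qed.

HB.instance Definition _ := isQuandle.Build (presented G0)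
  presented_inhabited presented_opxx presented_op_bij presented_op_dist.

End Presentation.

(* Arcs are indexed by 'I_p read cyclically, so that [ord_pred i] is i - 1
   modulo p: the relations are x_i ▷ x_(i-1) = x_(i-2). *)
Inductive torus_rel (p : nat) : qterm 'I_p -> qterm 'I_p -> Prop :=
| TorusRel (i : 'I_p) :
    torus_rel (QOp (QGen i) (QGen (ord_pred i)))
              (QGen (ord_pred (ord_pred i))).

(* The fundamental quandle of the (p,2)-torus link, the closure of the
   2-strand braid sigma_1 ^ p. *)
Definition torus_quandle (p : nat) (p_gt0 : 0 < p) : quandleType :=
  presented (@torus_rel p) (inhabits (Ordinal p_gt0)).

(* Directed multigraphs: [edge u v] is the type of the edges from u to v. *)
Record multidigraph := MultiDigraph {
  vertex : Type;
  edge : vertex -> vertex -> Type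
}.

Definition multidigraph_iso (A B : multidigraph) : Prop :=
  exists (F : vertex A -> vertex B)
         (E : forall u v : vertex A, edge u v -> edge (F u) (F v)),
    bijective F /\ forall u v : vertex A, bijective (E u v).

(* The full X-quandle coloring quiver of a link with fundamental quandle Q. *)
Definition coloring_quiver (X Q : quandleType) : multidigraph :=
  @MultiDigraph (quandle_hom Q X)
    (fun f g => {phi : quandle_hom X X | (g : Q -> X) = phi \o f}).

Definition complete_multidigraph (m k : nat) : multidigraph :=
  @MultiDigraph 'I_m (fun _ _ => 'I_k).

(* Main.v *)
Require Import Defs.
From mathcomp Require Import all_boot.
From mathcomp Require Import all_algebra boolp ring.

(** Write x ▷ y = 2y - x as saying that x, y, x ▷ y are consecutive terms of an
    arithmetic progression.  Everything then follows from one remark: a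
    sequence s with s (k+2) = s k ▷ s (k+1) in a dihedral quandle is the
    arithmetic progression through s 0 and s 1 ([dihedral_progression]).

    - Reading a coloring of the torus link along the arcs x_i, x_(i-1), ... gives
      such a sequence, and it returns to its start after p steps.  Its common
      difference d thus satisfies p d = 0, so d = 0 since p is invertible
      modulo n.  As the arcs generate the quandle, every coloring is constant
      ([torus_coloring_const]), and a coloring amounts to a single color: the
      quiver has n vertices.
    - Reading an endomorphism phi of Z_n along 0, 1, 2, ... shows that phi is
      affine ([dihedral_endo_affine]); conversely every affine map is an
      endomorphism.  An edge between the constant colorings a and b is an affine
      map sending a to b, and such a map is determined by its slope, which is
      arbitrary: there are n edges, whatever a and b are. *)

Set Implicit Arguments.
Unset Strict Implicit.
Unset Printing Implicit Defensive.

Import GRing.Theory.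
Local Open Scope ring_scope.
Local Open Scope quandle_scope.

Lemma quandle_hom_eq (X Y : quandleType) (f g : quandle_hom X Y) :
  f =1 g -> f = g.
Proof.
case: f g => [f fP] [g gP] /= /funext fg; case: _ / fg in gP *.
by congr QuandleHom; exact: Prop_irrelevance.
Qed.

(** Idempotence is what makes constant maps homomorphisms. *)
Definition const_hom (X Y : quandleType) (c : Y) : quandle_hom X Y :=
  QuandleHom (fun _ _ => esym (qopxx c) : (fun=> c) (_ : X) = _).

(** Induction on words.  For [QInv t u], the images under f and under g have the
    same image under the right translation by f u = g u, which is injective. *)
Lemma presented_hom_ext (G : Type) (R : qterm G -> qterm G -> Prop)
    (G0 : inhabited G) (Y : quandleType)
    (f g : quandle_hom (presented R G0) Y) :
  (forall x, f (presented_pi R G0 (QGen x)) = g (presented_pi R G0 (QGen x))) ->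
  f =1 g.
Proof.
have pi_op t u : presented_pi R G0 t ▷ presented_pi R G0 u
    = presented_pi R G0 (QOp t u) by exact: presented_opE.
move=> fg z; rewrite -[z]presented_reprK.
elim: (presented_repr z) => [x|t IHt u IHu|t IHt u IHu]; first exact: fg.
  by rewrite -pi_op !quandle_homP IHt IHu.
have invK : presented_pi R G0 (QInv t u) ▷ presented_pi R G0 u
    = presented_pi R G0 t.
  by rewrite pi_op; apply/presented_piP/qcong_invK.
apply: (bij_inj (qop_bij (f (presented_pi R G0 u)))).
by rewrite -quandle_homP invK IHu -quandle_homP invK.
Qed.

Lemma dihedral_progression (n : nat) (s : nat -> dihedral n) :
  (forall k, s k.+2 = s k ▷ s k.+1) ->
  forall k, s k = (s 0%N : 'Z_n) + ((s 1%N : 'Z_n) - s 0%N) *+ k.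
Proof.
move=> sP k.
(* The recurrence has order two, so two consecutive terms are carried along. *)
suff [] : s k = (s 0%N : 'Z_n) + ((s 1%N : 'Z_n) - s 0%N) *+ k
  /\ s k.+1 = (s 0%N : 'Z_n) + ((s 1%N : 'Z_n) - s 0%N) *+ k.+1 by [].
elim: k => [|k [IHk IHk1]]; first by rewrite mulr0n mulr1n addr0 addrC subrK.
split=> //; rewrite sP /qop /= /dihedral_op IHk IHk1 !mulrS; ring.
Qed.

Section DihedralEndomorphisms.
Variable n : nat.

Lemma dihedral_affine_morph (d b : 'Z_n) (x y : dihedral n) :
  d * (x ▷ y : dihedral n) + b
  = (d * x + b : dihedral n) ▷ (d * y + b : dihedral n) :> 'Z_n.
Proof. rewrite /qop /= /dihedral_op; ring. Qed.

Definition dihedral_affine (d b : 'Z_n) :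
    quandle_hom (dihedral n) (dihedral n) :=
  @QuandleHom (dihedral n) (dihedral n)
    (fun x => d * (x : 'Z_n) + b) (dihedral_affine_morph d b).

Definition slope (phi : dihedral n -> dihedral n) : 'Z_n :=
  phi (1 : 'Z_n) - (phi (0 : 'Z_n) : 'Z_n).

Lemma slope_affine (d b : 'Z_n) : slope (dihedral_affine d b) = d.
Proof. rewrite /slope /=; ring. Qed.

(** The points 0, 1, 2, ... are in progression, hence so are their images, and
    every x is the x-th of them. *)
Lemma dihedral_endo_affine (phi : quandle_hom (dihedral n) (dihedral n)) x :
  phi x = slope phi * (x : 'Z_n) + phi (0 : 'Z_n).
Proof.
pose s k : dihedral n := phi (k%:R : 'Z_n).
have sP k : s k.+2 = s k ▷ s k.+1.
  rewrite /s -quandle_homP; congr (quandle_hom_fun phi _).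
  by rewrite /qop /= /dihedral_op !mulrS; ring.
have xE : (x : 'Z_n)%:R = x :> 'Z_n by exact: natr_Zp.
have := dihedral_progression sP (x : 'Z_n).
have mulE (d : 'Z_n) : d *+ (x : 'Z_n) = d * (x : 'Z_n).
  by rewrite -mulr_natr; congr (_ * _); exact: xE.
by rewrite /s xE mulE addrC.
Qed.

(** The normal form adapted to edges: it is written from the slope and from one
    point (a, phi a) of the graph, where a is to be the color of the source. *)
Lemma dihedral_endo_through (phi : quandle_hom (dihedral n) (dihedral n))
    (a : dihedral n) :
  phi = dihedral_affine (slope phi)
          ((phi a : 'Z_n) - slope phi * (a : 'Z_n)).
Proof.
apply: quandle_hom_eq => x; rewrite (dihedral_endo_affine phi a).
rewrite (dihedral_endo_affine phi x) /=; ring.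
Qed.

End DihedralEndomorphisms.

Section TorusColorings.
Variables (p n : nat) (p_gt0 : (0 < p)%N).

Definition torus_arc (i : 'I_p) : torus_quandle p_gt0 :=
  presented_pi (@torus_rel p) (inhabits (Ordinal p_gt0)) (QGen i).

Lemma torus_arcP (i : 'I_p) :
  torus_arc i ▷ torus_arc (ord_pred i) = torus_arc (ord_pred (ord_pred i)).
Proof.
by rewrite /qop /= presented_opE; apply/presented_piP/qcong_rel/TorusRel.
Qed.

Lemma iter_ord_pred (i : 'I_p) : iter p (@ord_pred p) i = i.
Proof.
have iterE k : iter k (@ord_pred p) i = ((i + k * p.-1) %% p)%N :> nat.
  elim: k => [|k IHk]; first by rewrite mul0n addn0 modn_small.
  rewrite iterS /= IHk -subn1 -addnBA // subn1 modnDml mulSn.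
  by rewrite addnAC addnA.
by apply: val_inj; rewrite [LHS]iterE addnC mulnC modnMDl modn_small.
Qed.

Hypotheses (n_gt1 : (1 < n)%N) (coprime_pn : coprime p n).

(** Walking once around the p arcs adds p times the difference of two
    consecutive colors, and p is invertible modulo n, so that difference is 0. *)
Lemma torus_coloring_pred (f : quandle_hom (torus_quandle p_gt0) (dihedral n))
    (i : 'I_p) :
  f (torus_arc (ord_pred i)) = f (torus_arc i).
Proof.
pose s k := f (torus_arc (iter k (@ord_pred p) i)).
have sP k : s k.+2 = s k ▷ s k.+1 by rewrite /s -quandle_homP torus_arcP.
have := dihedral_progression sP p; rewrite {1}/s iter_ord_pred -/(s 0%N).
rewrite -[LHS]addr0 => /addrI/esym; rewrite -mulr_natr => dp0.
have p_unit : (p%:R : 'Z_n) \is a GRing.unit by rewrite unitZpE // coprime_sym.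
by apply/eqP; rewrite -subr_eq0; apply/eqP/(mulIr p_unit); rewrite mul0r.
Qed.

Lemma torus_coloring_const
    (f : quandle_hom (torus_quandle p_gt0) (dihedral n)) x :
  f x = f (torus_arc (Ordinal p_gt0)).
Proof.
suff /(_ x) : f =1 const_hom _ (f (torus_arc (Ordinal p_gt0))) by [].
apply: presented_hom_ext => -[i i_lt]; rewrite -/(torus_arc _) /=.
elim: i i_lt => [|i IHi] i_lt.
  by congr (f (torus_arc _)); exact: val_inj.
rewrite -(IHi (ltnW i_lt)) -torus_coloring_pred; congr (f (torus_arc _)).
by apply: val_inj; rewrite /= modnDr modn_small // ltnW.
Qed.

End TorusColorings.

Local Close Scope ring_scope.

Theorem theorem8 (p n : nat) (p_gt0 : 0 < p) (n_gt1 : 1 < n)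
    (coprime_pn : coprime p n) :
  multidigraph_iso
    (coloring_quiver (dihedral n) (torus_quandle p_gt0))
    (complete_multidigraph n n).
Proof.
have constE := torus_coloring_const (p_gt0 := p_gt0) n_gt1 coprime_pn.
(* Once n is a double successor, 'I_n and the carrier 'Z_n are convertible. *)
case: n n_gt1 {coprime_pn} constE => [|[|m]] // n_gt1.
set c0 := torus_arc p_gt0 (Ordinal p_gt0) => constE.
pose Q := coloring_quiver (dihedral m.+2) (torus_quandle p_gt0).
pose color (f : vertex Q) : 'I_m.+2 := quandle_hom_fun f c0.
pose edge_slope (f g : vertex Q) (e : edge f g) : 'I_m.+2 := slope (sval e).
exists color, edge_slope; split=> [|f g].
  exists (fun c => const_hom _ (c : dihedral m.+2)) => // f.
  by apply: quandle_hom_eq => x; rewrite [RHS]constE.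
(* The affine map of slope d that sends the color of f to the color of g. *)
pose phi (d : 'Z_m.+2) : quandle_hom (dihedral m.+2) (dihedral m.+2) :=
  dihedral_affine d (color g - d * color f)%R.
have phiP d : quandle_hom_fun g = phi d \o quandle_hom_fun f.
  by apply/funext => x; rewrite /= !(constE _ x) addrC subrK.
exists (fun d => exist _ (phi d) (phiP d)) => [[psi psiP]|d]; last first.
  exact: (slope_affine (d : 'Z_m.+2)).
apply: eq_exist; rewrite [RHS](@dihedral_endo_through m.+2 psi (color f)).
by rewrite /phi /edge_slope /color /= psiP.
Qed.
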